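(* Let $1\le M<N$, $w=e^{2\pi \mathrm{i}/N}$, and let $F_{M,N}$ be the $M\times N$ matrix with rows $H_i=(w^{(i-1)k})_{k=0}^{N-1}$, $i=1,\dots,M$ (the upper $M\times N$ submatrix of the Fourier matrix $F_N$). Let $G_{M,N}\subset\widetilde S_M$ be its associated semigroup, i.e. the semigroup generated under composition by the partial permutations $\sigma_x$, for $x$ ranging over the residues $j-i \bmod N$ with $1\le i,j\le M$, where $\sigma_x(j)=i$ iff $j-i\equiv x\pmod N$. Let $G'_{M,N}$ be the set of partial permutations $\sigma:I\to J$ of the form $\sigma(j)=j-x$ for some integer $x$, with $I,J\subset\{1,\dots,M\}$ intervals (including the empty map). For a partial permutation $\sigma:I\to J$ let $\kappa(\sigma)=|I|$. Then: (1) if $N>2M-2$, then $G_{M,N}=G'_{M,N}$; (2) if $M<N\le2M-2$, then for every $k>2M-N$ one has $\{\sigma\in G_{M,N}\mid\kappa(\sigma)=k\}=\{\sigma\in G'_{M,N}\mid\kappa(\sigma)=k\}$.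
   Context: $\widetilde S_M$ is the set of partial permutations of $\{1,\dots,M\}$, i.e. bijections $\sigma:I\to J$ with $I,J\subset\{1,\dots,M\}$, composed as partial maps. $F_{M,N}$ is a partial Hadamard matrix of classical type (the quotient vectors $H_i/H_j=\rho^{i-j}$ with $\rho=(w^k)_k$ are pairwise equal or orthogonal), and the semigroup associated to it is the classical semigroup described in the claim.
   Formalization: Part (1) is false for M = 1, where the semigroup G is {id} while G' also contains the empty map; the formal statement proves (1) for M ≥ 2 and, for M = 1, that G equals G' without the empty map. *)

(* Defs.v *)
From HB Require Import structures.
From mathcomp Require Import all_boot all_order all_algebra.
From mathcomp Require Import ring.
From mathcomp Require Export boolp classical_sets.

Set Implicit Arguments.
Unset Strict Implicit.
Unset Printing Implicit Defensive.

Import GRing.Theory.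

Local Open Scope classical_set_scope.
Local Open Scope ring_scope.

(* The index set {1, ..., M} is encoded as 'I_M = {0, ..., M - 1}; only         *)
(* differences of indices and order-intervals matter, so the shift is harmless. *)

Fact eqz_modP (a b : int) (N : nat) : (a = b %[mod N])%Z <-> (N %| a - b)%Z.
Proof. by rewrite -eqz_mod_dvd; split=> /eqP. Qed.

Fact dvdzNr (a : int) (N : nat) : (N %| - a)%Z = (N %| a)%Z.
Proof. by rewrite !dvdzE abszN. Qed.

Section PartialPermutations.
Variable M : nat.
Implicit Types f : {ffun 'I_M -> option 'I_M}.

(* [f j = None] means that f is undefined at j. *)
Definition pinjective f : bool :=
  [forall j1, forall j2, (f j1 != None) && (f j1 == f j2) ==> (j1 == j2)].

Lemma pinjectiveP f :
  reflect (forall i j1 j2, f j1 = Some i -> f j2 = Some i -> j1 = j2)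
          (pinjective f).
Proof.
apply: (iffP forallP) => [injf i j1 j2 f1 f2|injf j1].
  by have /forallP/(_ j2) := injf j1; rewrite f1 f2 eqxx => /eqP.
apply/forallP => j2; apply/implyP => /andP[]; case f1: (f j1) => [i|] // _.
by move=> /eqP f2; apply/eqP/(injf i).
Qed.

Record pperm := PPerm { pperm_val :> {ffun 'I_M -> option 'I_M};
                        pperm_inj : pinjective pperm_val }.

HB.instance Definition _ := [isSub for pperm_val].
HB.instance Definition _ := [Finite of pperm by <:].

Implicit Types s t : pperm.

Definition pdom s : {set 'I_M} := [set j | s j != None]%SET.
Definition pcodom s : {set 'I_M} := [set i | [exists j, s j == Some i]]%SET.

Definition kappa s : nat := #|pdom s|.

Fact pperm0_subproof : pinjective [ffun=> None].
Proof. by apply/pinjectiveP => i j1 j2; rewrite ffunE. Qed.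
Definition pperm0 : pperm := PPerm pperm0_subproof.

Fact pmul_subproof s t : pinjective [ffun j => obind s (t j)].
Proof.
apply/pinjectiveP => i j1 j2; rewrite !ffunE.
case t1: (t j1) => [k1|] //=; case t2: (t j2) => [k2|] //= s1 s2.
have /pinjectiveP injs := pperm_inj s; have /pinjectiveP injt := pperm_inj t.
by rewrite (injs _ _ _ s1 s2) in t1; apply: injt t1 t2.
Qed.
(* Composition of partial maps: t is applied first. *)
Definition pmul s t : pperm := PPerm (pmul_subproof s t).

Definition pmul_closed (A : set pperm) : Prop :=
  forall s t, A s -> A t -> A (pmul s t).

(* The empty set is an interval (take b < a). *)
Definition interval_set (A : {set 'I_M}) : Prop :=
  exists a b : nat, A = [set i : 'I_M | (a <= i <= b)%N]%SET.

(* G'_{M,N}, which does not depend on N. The empty map belongs to it. *)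
Definition translations : set pperm :=
  [set s | [/\ interval_set (pdom s), interval_set (pcodom s)
             & exists x : int,
                 forall i j, s j = Some i -> i%:Z = j%:Z - x]].

(* [is_sigma N x s] says that s is sigma_x; it depends only on x modulo N. *)
Definition is_sigma (N : nat) (x : int) s : Prop :=
  forall i j, s j = Some i <-> (j%:Z - i%:Z = x %[mod N])%Z.

Definition fourier_generators (N : nat) : set pperm :=
  [set s | exists i j : 'I_M, is_sigma N (j%:Z - i%:Z) s].

(* G_{M,N}. For M = 1 it is {id}: the empty map is then not generated, whereas
   it always belongs to [translations M]. *)
Definition fourier_semigroup (N : nat) : set pperm :=
  smallest pmul_closed (fourier_generators N).

Lemma fourier_semigroup_closed N : pmul_closed (fourier_semigroup N).
Proof.
by move=> s t Gs Gt A AP; have [cA _] := AP; exact: cA (Gs A AP) (Gt A AP).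
Qed.

Lemma translations0 : translations pperm0.
Proof.
split; last by exists 0 => i j; rewrite ffunE.
- exists 1%N, 0%N; apply/setP => i; rewrite !inE ffunE eqxx.
  by case: (nat_of_ord i).
- exists 1%N, 0%N; apply/setP => i; rewrite !inE.
  rewrite (_ : (0 < i <= 0)%N = false); last by case: (nat_of_ord i).
  by apply/existsP => -[j]; rewrite ffunE.
Qed.

Lemma is_sigma_ex (N : nat) (x : int) : (M <= N)%N -> exists! s, is_sigma N x s.
Proof.
move=> leMN.
have uq (i1 i2 : 'I_M) : (i1%:Z = i2%:Z %[mod N])%Z -> i1 = i2.
  rewrite !modz_nat !modn_small ?(leq_trans (ltn_ord _)) // => -[] e.
  exact: val_inj.
have symm (i j : 'I_M) : (j%:Z - i%:Z = x %[mod N])%Z <->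
    (i%:Z = j%:Z - x %[mod N])%Z.
  rewrite !eqz_modP -[(N %| i%:Z - _)%Z]dvdzNr.
  by rewrite (_ : - (i%:Z - (j%:Z - x)) = j%:Z - i%:Z - x) //; ring.
have symm' (i j : 'I_M) : (j%:Z - i%:Z = x %[mod N])%Z <->
    (j%:Z = i%:Z + x %[mod N])%Z.
  by rewrite !eqz_modP (_ : j%:Z - (i%:Z + x) = j%:Z - i%:Z - x) //; ring.
pose f := [ffun j : 'I_M =>
  [pick i : 'I_M | (j%:Z - i%:Z == x %[mod N])%Z]].
have fP i j : f j = Some i <-> (j%:Z - i%:Z = x %[mod N])%Z.
  rewrite ffunE; case: pickP => [k /eqP kP|nP]; split=> //.
  - by case=> <-.
  - by move=> /symm iP; congr Some; apply: uq; rewrite iP; apply/symm.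
  - by move=> /eqP; rewrite nP.
have injf : pinjective f.
  apply/pinjectiveP => i j1 j2 /fP/symm' e1 /fP/symm' e2.
  by apply: uq; rewrite e1 e2.
exists (PPerm injf); split=> [//|s sP]; apply/val_inj/ffunP => j /=.
case fj: (f j) => [i|]; first by apply/esym/sP/fP.
by case sj: (s j) => [i|//]; move/sP/fP: sj; rewrite fj.
Qed.

End PartialPermutations.

Arguments translations : clear implicits.
Arguments fourier_generators : clear implicits.
Arguments fourier_semigroup : clear implicits.

(* The matrix F_{M,N}, for w a primitive N-th root of unity such as            *)
(* exp (2 * pi * i / N). The lemma below identifies sigma_x with the partial    *)
(* permutation attached to the quotient vector rho^(-x), rho = (w^k)_k, among   *)
(* the H_i / H_j = rho^(i - j).                                                 *)
Definition fourier_mx (C : fieldType) (w : C) (M N : nat) : 'M[C]_(M, N) :=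
  \matrix_(i < M, k < N) w ^+ (i * k).

Lemma fourier_quotientP (C : fieldType) (w : C) (M N : nat) (i j : 'I_M)
    (x : int) : (1 < N)%N -> N.-primitive_root w ->
  (forall k, fourier_mx w M N i k / fourier_mx w M N j k = (w ^ (- x)) ^+ k) <->
  (j%:Z - i%:Z = x %[mod N])%Z.
Proof.
move=> N_gt1 wP; have w_neq0 : w != 0.
  apply/eqP => w0; have := prim_expr_order wP.
  by rewrite w0 expr0n -leqn0 leqNgt (ltnW N_gt1) => /esym/eqP; rewrite oner_eq0.
have wU : w \is a GRing.unit by rewrite unitfE.
have w1P (z : int) : w ^ z = 1 <-> (N %| z)%Z.
  rewrite dvdzE; case: z => n.
    by rewrite -exprnP (prim_order_dvd wP); split=> /eqP.
  rewrite NegzE abszN -exprz_inv -exprnP exprVn (prim_order_dvd wP).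
  by rewrite -invr_eq1; split=> /eqP.
have qE k : fourier_mx w M N i k / fourier_mx w M N j k
            = (w ^ (i%:Z - j%:Z)) ^+ k.
  by rewrite !mxE !exprM -expr_div_n expfzDr // -exprz_inv -!exprnP exprVn.
have wE (a b : int) : w ^ a = w ^ b <-> w ^ (a - b) = 1.
  have wb0 := expfz_neq0 b w_neq0; split=> [h|h].
    by apply: (mulIf wb0); rewrite -expfzDr // subrK mul1r.
  by rewrite -[a](subrK b) expfzDr // h mul1r.
have expE : w ^ (i%:Z - j%:Z) = w ^ (- x) <-> (j%:Z - i%:Z = x %[mod N])%Z.
  rewrite wE w1P eqz_modP -dvdzNr.
  by rewrite (_ : - (i%:Z - j%:Z - - x) = j%:Z - i%:Z - x) //; ring.
rewrite -expE; split=> [h|h k]; last by rewrite qE h.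
by have := h (Ordinal N_gt1); rewrite qE !expr1.
Qed.

(* Main.v *)
Require Import Defs.
From mathcomp Require Import all_boot all_order all_algebra.
From mathcomp Require Import zify.

Import GRing.Theory.

Local Open Scope classical_set_scope.

(** If |x| <= N - M, then sigma_x does not wrap around modulo N: it is the full
    translation by -x. Otherwise sigma_x is undefined on N - M consecutive
    points, so that kappa(sigma_x) <= 2M - N. As kappa does not increase under
    composition, only translations contribute to the elements of G with
    kappa > 2M - N. Conversely, the translation by -x on the interval
    [a, M - 1 - c] is sigma_x sigma_c sigma_(-c) sigma_(-a) sigma_a, and
    |x|, a, c <= M - kappa. *)

(** * Partial permutations as relations, and the behaviour of [kappa] under composition *)

Lemma pperm_ext (M : nat) (s t : pperm M) :
  (forall i j, s j = Some i <-> t j = Some i) -> s = t.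
Proof.
move=> st; apply/val_inj/ffunP => j /=.
case sj: (s j) => [i|]; first by apply/esym/st.
by case tj: (t j) => [i|//]; move/st: tj; rewrite sj.
Qed.

Lemma pmulP (M : nat) (s t : pperm M) i j :
  pmul s t j = Some i <-> exists2 k, t j = Some k & s k = Some i.
Proof.
rewrite ffunE; split=> [|[k -> //]].
by case: (t j) => [k|//] /= sk; exists k.
Qed.

Lemma pdomP (M : nat) (s : pperm M) j :
  reflect (exists i, s j = Some i) (j \in pdom s).
Proof.
rewrite inE; case: (s j) => [i|]; constructor; first by exists i.
by case.
Qed.

Lemma pcodomP (M : nat) (s : pperm M) i :
  reflect (exists j, s j = Some i) (i \in pcodom s).
Proof. by rewrite inE; apply: (iffP existsP) => -[j /eqP sj]; exists j => //; exact/eqP. Qed.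

Lemma kappa_eq0 (M : nat) (s : pperm M) : kappa s = 0%N -> s = pperm0 M.
Proof.
move=> /eqP; rewrite cards_eq0 => /eqP s0; apply: pperm_ext => i j.
rewrite ffunE; split=> // sj.
have : j \in pdom s by apply/pdomP; exists i.
by rewrite s0 inE.
Qed.

(** The map [t] sends the domain of the product injectively into that of [s]; the count takes place
    in [option 'I_M]. *)
Lemma kappa_pmul_l (M : nat) (s t : pperm M) : (kappa (pmul s t) <= kappa s)%N.
Proof.
have dt j : j \in pdom (pmul s t) -> exists2 k, t j = Some k & k \in pdom s.
  by move=> /pdomP[i /pmulP[k tk sk]]; exists k => //; apply/pdomP; exists i.
rewrite /kappa -(card_in_imset (f := t)); last first.
  move=> j1 j2 /dt[k1 t1 _] /dt[k2 t2 _]; rewrite t1 t2 => -[k12].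
  by move/pinjectiveP: (pperm_inj t); apply; [exact: t1|rewrite k12].
apply: leq_trans (leq_imset_card Some _); apply/subset_leq_card.
apply/fintype.subsetP => _ /imsetP[j /dt[k -> sk] ->].
exact: imset_f.
Qed.

Lemma kappa_pmul_r (M : nat) (s t : pperm M) : (kappa (pmul s t) <= kappa t)%N.
Proof.
apply/subset_leq_card/fintype.subsetP => j /pdomP[i /pmulP[k tk _]].
by apply/pdomP; exists k.
Qed.

(** * Intervals of ['I_M] and bounds on cardinals *)

Definition ord_convex (M : nat) (A : {set 'I_M}) : Prop :=
  forall i j k : 'I_M, (i <= j <= k)%N -> i \in A -> k \in A -> j \in A.

Lemma ord_convex_bounds (M : nat) (A : {set 'I_M}) :
  ord_convex M A -> A != finset.set0 ->
  exists a b : 'I_M, [/\ a \in A, b \in A &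
    forall i : 'I_M, (i \in A) = (a <= i <= b)%N].
Proof.
move=> cA /set0Pn[i0 Ai0].
have [a Aa mina] := arg_minnP (fun i : 'I_M => i : nat) Ai0.
have [b Ab maxb] := arg_maxnP (fun i : 'I_M => i : nat) Ai0.
exists a, b; split=> // i; apply/idP/idP => [Ai|aib]; last exact: cA aib Aa Ab.
by apply/andP; split; [exact: mina|exact: maxb].
Qed.

Lemma interval_setP (M : nat) (A : {set 'I_M}) :
  interval_set A <-> ord_convex M A.
Proof.
split=> [[a [b ->]] i j k|cA]; first by rewrite !inE; lia.
have [->|/(ord_convex_bounds _ _ cA)[a [b [_ _ Aab]]]] := eqVneq A finset.set0.
  by exists 1%N, 0%N; apply/setP => i; rewrite !inE; lia.
by exists a, b; apply/setP => i; rewrite Aab inE.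
Qed.

Lemma card_ord_interval (M : nat) (a b : nat) (A : {set 'I_M}) :
  (forall i : 'I_M, i \in A -> (a <= i <= b)%N) -> (#|A| <= b.+1 - a)%N.
Proof.
move=> Aab; rewrite cardE -(size_map val) -(size_iota a (b.+1 - a)).
apply: uniq_leq_size; first by rewrite (map_inj_uniq val_inj) enum_uniq.
move=> _ /mapP[i + ->]; rewrite mem_enum => /Aab; rewrite mem_iota /=; lia.
Qed.

Lemma card_ord_avoid (M : nat) (a n : nat) (A : {set 'I_M}) :
  (a + n <= M)%N -> (forall i : 'I_M, i \in A -> ~~ (a <= i < a + n)%N) ->
  (#|A| <= M - n)%N.
Proof.
move=> anM Aan.
suff: (n <= #|~: A|)%N by have := cardsC A; rewrite card_ord; lia.
rewrite cardE -(size_map val) -[X in (X <= _)%N](size_iota a n).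
apply: uniq_leq_size; first exact: iota_uniq.
move=> m; rewrite mem_iota => man; have mM : (m < M)%N by lia.
apply/mapP; exists (Ordinal mM) => //; rewrite mem_enum inE.
by apply/negP => /Aan; rewrite man.
Qed.

(** A translation carries intervals to intervals: a point [i] between two values is the value at
    [i + x], which lies between their preimages. *)
Lemma translationsP (M : nat) (s : pperm M) :
  translations M s <-> ord_convex M (pdom s) /\
    exists x : int, forall i j, s j = Some i -> (i%:Z = j%:Z - x)%R.
Proof.
split=> [[/interval_setP]|[cs [x sx]]]; first by [].
split; [exact/interval_setP| |by exists x].
apply/interval_setP => i1 i i2 i12 /pcodomP[j1 s1] /pcodomP[j2 s2].
have e1 := sx _ _ s1; have e2 := sx _ _ s2.
have ltj : (`|(i%:Z + x)%R|%N < M)%N by have := ltn_ord j2; lia.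
pose j := Ordinal ltj; have ej : (j%:Z = i%:Z + x)%R by rewrite /j /=; lia.
have /pdomP[k sk] : j \in pdom s.
  apply: (cs j1 j j2); first lia.
    by apply/pdomP; exists i1.
  by apply/pdomP; exists i2.
apply/pcodomP; exists j; rewrite sk; congr Some; apply: val_inj => /=.
have := sx _ _ sk; lia.
Qed.

Lemma translations_closed (M : nat) : pmul_closed (translations M).
Proof.
move=> s t /translationsP[cs [x sx]] /translationsP[ct [y ty]].
apply/translationsP; split; last first.
  by exists (x + y)%R => i j /pmulP[k /ty e1 /sx e2]; lia.
move=> j1 j j2 j12 /pdomP[i1 /pmulP[k1 t1 s1]] /pdomP[i2 /pmulP[k2 t2 s2]].
have /pdomP[k tk] : j \in pdom t.
  by apply: (ct j1 j j2) => //; apply/pdomP; [exists k1|exists k2].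
have /pdomP[i si] : k \in pdom s.
  apply: (cs k1 k k2); last 2 first.
  - by apply/pdomP; exists i1.
  - by apply/pdomP; exists i2.
  have := ty _ _ t1; have := ty _ _ t2; have := ty _ _ tk; lia.
by apply/pdomP; exists i; apply/pmulP; exists k.
Qed.

(** * Generators that do not wrap around, and those that do *)

Definition is_shift (M : nat) (x : int) (s : pperm M) : Prop :=
  forall i j : 'I_M, s j = Some i <-> (j%:Z - i%:Z = x)%R.

Lemma is_shift_translation (M : nat) (x : int) (s : pperm M) :
  is_shift M x s -> translations M s.
Proof.
move=> sx; apply/translationsP; split; last first.
  by exists x => i j /sx; lia.
move=> j1 j j2 j12 /pdomP[i1 /sx e1] /pdomP[i2 /sx e2].
have lti : (`|(j%:Z - x)%R|%N < M)%N by have := ltn_ord i2; lia.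
by apply/pdomP; exists (Ordinal lti); apply/sx => /=; lia.
Qed.

(** Since |j - i| < M and |x| <= N - M, the difference j - i - x is smaller than N in absolute
    value, so it is divisible by N only if it is 0. *)
Lemma is_sigma_shift (M N : nat) (x : int) (s : pperm M) :
  (`|x|%N + M <= N)%N -> is_sigma N x s -> is_shift M x s.
Proof.
move=> xN sx i j; rewrite sx eqz_modP dvdzE; split=> [/dvdnP[q]|->]; last first.
  by rewrite subrr.
have := ltn_ord i; have := ltn_ord j.
by case: q => [|q]; lia.
Qed.

(* The undefined points are y - (N - M), ..., y - 1, where y is the residue of
   x in [0, N). *)
Lemma is_sigma_wrap_kappa (M N : nat) (x : int) (s : pperm M) :
  (M < N)%N -> (`|x|%N < M)%N -> (N < `|x|%N + M)%N -> is_sigma N x s ->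
  (kappa s <= 2 * M - N)%N.
Proof.
move=> MN xM Nx sx.
have [y [yx yl yu]] : exists y : nat,
    [/\ (N %| (x - y%:Z)%R)%Z, (N < y + M)%N & (y < M)%N].
  case: (Num.Theory.ger0P x) => x0.
    exists `|x|%N; split; [|lia|lia].
    by rewrite (_ : x - _ = 0)%R ?dvdz0 //; lia.
  exists (N - `|x|%N)%N; split; [|lia|lia].
  by rewrite (_ : x - _ = - N%:Z)%R ?dvdzNr ?dvdzz //; lia.
rewrite (_ : 2 * M - N = M - (N - M))%N; last lia.
apply: (@card_ord_avoid M (y - (N - M))); first lia.
move=> j /pdomP[i /sx/eqz_modP ji]; apply/negP => jy.
have : (N %| (j%:Z - i%:Z - y%:Z)%R)%Z.
  rewrite (_ : (_ - _ - _ = (j%:Z - i%:Z - x) + (x - y%:Z))%R); last lia.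
  exact: rpredD.
(* For y - (N - M) <= j < y and 0 <= i < M, the number j - i - y lies strictly between -N and 0. *)
rewrite dvdzE => /dvdnP[q]; have := ltn_ord i; have := ltn_ord j.
by case: q => [|[|q]]; lia.
Qed.

Lemma fourier_generator_shift (M N : nat) (x : int) :
  (M < N)%N -> (`|x|%N < M)%N -> (`|x|%N + M <= N)%N ->
  exists2 s, fourier_semigroup M N s & is_shift M x s.
Proof.
move=> MN xM xN; have [s [sx _]] := @is_sigma_ex M N x (ltnW MN).
exists s; last exact: is_sigma_shift xN sx.
move=> A [_]; apply; have M0 : (0 < M)%N by lia.
case: (Num.Theory.ger0P x) => x0.
  exists (Ordinal M0), (Ordinal xM) => /=.
  by rewrite (_ : (_ - _ = x)%R); [|lia].
exists (Ordinal xM), (Ordinal M0) => /=.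
by rewrite (_ : (_ - _ = x)%R); [|lia].
Qed.

(** * Comparison of the semigroup with the translations *)

Lemma fourier_semigroup_restricted_shift (M N a c : nat) (x : int) (s : pperm M) :
  (M < N)%N -> (a < M)%N -> (a + M <= N)%N -> (c < M)%N -> (c + M <= N)%N ->
  (`|x|%N < M)%N -> (`|x|%N + M <= N)%N ->
  (forall i j : 'I_M, s j = Some i <->
     [/\ (a <= j)%N, (j + c < M)%N & (j%:Z - i%:Z = x)%R]) ->
  fourier_semigroup M N s.
Proof.
move=> MN aM aN cM cN xM xN sP.
have [sa Ga saP] := @fourier_generator_shift M N a%:Z MN aM aN.
have [sa' Ga' sa'P] : exists2 s, fourier_semigroup M N s & is_shift M (- a%:Z)%R s.
  by apply: fourier_generator_shift; lia.
have [sc Gc scP] := @fourier_generator_shift M N c%:Z MN cM cN.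
have [sc' Gc' sc'P] : exists2 s, fourier_semigroup M N s & is_shift M (- c%:Z)%R s.
  by apply: fourier_generator_shift; lia.
have [sx Gx sxP] := @fourier_generator_shift M N x MN xM xN.
(* [sa' sa] is the identity on the points j >= a, and [sc sc'] the identity on the points j < M -
   c. *)
rewrite (_ : s = pmul sx (pmul sc (pmul sc' (pmul sa' sa)))).
  by do 4!(apply: fourier_semigroup_closed => //).
apply: pperm_ext => i j; rewrite sP; split=> [[aj jc ji]|].
  have lt1 : (j - a < M)%N by have := ltn_ord j; lia.
  apply/pmulP; exists j; last exact/sxP.
  apply/pmulP; exists (Ordinal jc); last by apply/scP => /=; lia.
  apply/pmulP; exists j; last by apply/sc'P => /=; lia.
  apply/pmulP; exists (Ordinal lt1); last by apply/sa'P => /=; lia.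
  by apply/saP => /=; lia.
move=> /pmulP[k4 /pmulP[k3 /pmulP[k2 /pmulP[k1 /saP e1 /sa'P e2] /sc'P e3]]].
move=> /scP e4 /sxP e5; have := ltn_ord k3; split; lia.
Qed.

Lemma translations_fourier_semigroup (M N : nat) (s : pperm M) :
  (M < N)%N -> translations M s -> (0 < kappa s)%N -> (2 * M - N <= kappa s)%N ->
  fourier_semigroup M N s.
Proof.
move=> MN /translationsP[cs [x sx]] s0 sN.
have [] := @ord_convex_bounds M (pdom s) cs; first by rewrite -card_gt0.
move=> a [b [/pdomP[ia sa] /pdomP[ib sb] dE]].
have kb : (kappa s <= b.+1 - a)%N by apply: card_ord_interval => i; rewrite dE.
have ea := sx _ _ sa; have eb := sx _ _ sb.
have := ltn_ord a; have := ltn_ord b; have := ltn_ord ia; have := ltn_ord ib.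
move=> ltib ltia ltb lta.
(* With c = M - 1 - b, the bound [kb] gives a + c <= M - kappa <= N - M. As a - x >= 0 and b - x <=
   M - 1, also -c <= x <= a. *)
apply: (@fourier_semigroup_restricted_shift M N a (M.-1 - b)%N x); try lia.
move=> i j; split=> [sj|[aj jb ji]].
  have : j \in pdom s by apply/pdomP; exists i.
  by rewrite dE => /andP[aj jb]; have := sx _ _ sj; split; lia.
have /pdomP[k sk] : j \in pdom s by rewrite dE; lia.
by rewrite sk; congr Some; apply: val_inj => /=; have := sx _ _ sk; lia.
Qed.

Lemma fourier_semigroup_translations (M N : nat) (s : pperm M) :
  (M < N)%N -> fourier_semigroup M N s ->
  (2 * M - 2 < N)%N \/ (2 * M - N < kappa s)%N -> translations M s.
Proof.
(* The hypothesis on [kappa] is part of the invariant: a product of large [kappa] has both factors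
   of large [kappa]. *)
move=> MN Gs; apply: (Gs [set s | _ -> translations M s]); split.
  move=> {Gs}s t As At stN; apply: translations_closed.
    apply: As; have := @kappa_pmul_l M s t; lia.
  by apply: At; have := @kappa_pmul_r M s t; lia.
move=> {Gs}s [i [j sx]] sN; have := ltn_ord i; have := ltn_ord j => ltj lti.
have [xN|xN] := leqP (`|(j%:Z - i%:Z)%R|%N + M) N.
  exact: is_shift_translation (is_sigma_shift _ _ _ _ xN sx).
(* Wrapping forces N < |j - i| + M <= 2M - 1, which excludes the first alternative of [sN]; the
   bound on [kappa] excludes the second. *)
have := @is_sigma_wrap_kappa M N _ s MN _ xN sx; lia.
Qed.

(** The shift by M - 1 is defined only at M - 1, with value 0, which differs from M - 1 for M > 1;
    so its square is empty. *)
Lemma pperm0_fourier_semigroup (M N : nat) :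
  (1 < M)%N -> (2 * M - 2 < N)%N -> fourier_semigroup M N (pperm0 M).
Proof.
move=> M1 MN.
have [s Gs sP] : exists2 s, fourier_semigroup M N s & is_shift M (M.-1)%:Z s.
  by apply: fourier_generator_shift; lia.
rewrite (_ : pperm0 M = pmul s s); first exact: fourier_semigroup_closed.
apply: pperm_ext => i j; rewrite ffunE; split=> // /pmulP[k /sP e1 /sP e2].
have := ltn_ord j; lia.
Qed.

Theorem theorem5p9 (M N : nat) (M_ge1 : (1 <= M)%N) (ltMN : (M < N)%N) :
  [/\ (2 * M - 2 < N)%N -> (1 < M)%N ->
        fourier_semigroup M N = translations M,
      M = 1%N -> fourier_semigroup M N = translations M `\ pperm0 M
    & (N <= 2 * M - 2)%N -> forall k : nat, (2 * M - N < k)%N ->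
        [set s | fourier_semigroup M N s /\ kappa s = k] =
        [set s | translations M s /\ kappa s = k]].
Proof.
split=> [MN M1|M1|NM k kN]; apply/seteqP; split=> s.
- by move=> Gs; apply: fourier_semigroup_translations Gs _ => //; left.
- move=> Ts; case: (posnP (kappa s)) => [/kappa_eq0 ->|s0].
    exact: pperm0_fourier_semigroup.
  (* Here 2M - N <= 1, so every nonempty translation is large enough. *)
  by apply: translations_fourier_semigroup => //; lia.
- move=> Gs; split.
    by apply: fourier_semigroup_translations Gs _ => //; left; lia.
  pose o := Ordinal M_ge1.
  (* For M = 1, fixing the only point is an invariant of the semigroup, which rules out the empty
     map. *)
  suff: s o = Some o by move=> /[swap] ->; rewrite ffunE.
  apply: (Gs [set s | s o = Some o]); split=> {Gs}s.
    by move=> t so to_; apply/pmulP; exists o.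
  move=> [i [j sx]]; apply/sx; congr (_ %% _)%Z.
  by have := ltn_ord i; have := ltn_ord j; rewrite /=; lia.
- move=> [Ts s0]; have [/kappa_eq0 //|sp] := posnP (kappa s).
  by apply: translations_fourier_semigroup => //; lia.
- move=> [Gs sk]; split=> //.
  by apply: fourier_semigroup_translations Gs _ => //; right; rewrite sk.
- move=> [Ts sk]; split=> //.
  by apply: translations_fourier_semigroup => //; lia.
Qed.
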